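(* Let $\mathcal V=\{V;\nu_1,\dots,\nu_n\}$ be a vector arrangement over $\Bbbk$ with associated hyperplane arrangement $\mathcal H$, and let $H_l\in\mathcal H$. There is a short exact sequence of chain complexes of the form $$0\to C_d^{i-1,j}(\mathcal H^{H_l})\xrightarrow{\ \iota\ }C_d^{i,j}(\mathcal H)\xrightarrow{\ \pi\ }C_d^{i,j}(\mathcal H-H_l)\to0.$$ This induces a long exact sequence $$0\to\cdots\to H_d^{i-1}(\mathcal H^{H_l})\to H_d^i(\mathcal H)\to H_d^i(\mathcal H-H_l)\to H_d^i(\mathcal H^{H_l})\to\cdots$$
   Context: Let $\Bbbk$ be a field of characteristic zero. A vector arrangement $\mathcal V=\{V;\nu_1,\dots,\nu_n\}$ is a finite-dimensional $\Bbbk$-vector space $V$ with an inner product together with a list of vectors $\nu_i\in V$ (zero allowed). The associated hyperplane arrangement is $\mathcal H=\{V;H_1,\dots,H_n\}$, $H_i=\nu_i^\perp$. For $S\subseteq[n]=\{1,\dots,n\}$ put $H_S=\bigcap_{s\in S}H_s$ ($H_\emptyset=V$). The inner product is understood to restrict non-degenerately to all subspaces onto which orthogonal projections are taken. Deletion: $\mathcal H-H_l$ is the arrangement in $V$ with $H_l$ removed (from $\mathcal V-\nu_l$). Restriction: $\mathcal H^{H_l}$ is the arrangement in $H_l$ consisting of the $H_i\cap H_l$, $i\ne l$ (from the vectors $P(\nu_i)$, $i\neq l$, with $P$ the orthogonal projection onto $\nu_l^\perp$). Both are indexed by $[n]\setminus\{l\}$ with the induced order. Chain complex $C_d(\mathcal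 H)$: $C_d^{i,j}(\mathcal H)=\bigoplus_{|S|=i}\bigwedge^jH_S$, with $i$ the homological degree. For $r\notin S$ let $d_{S,r}:\bigwedge^\bullet H_S\to\bigwedge^\bullet H_{S\cup r}$ be induced by the orthogonal projection $H_S\to H_{S\cup r}$, and $\varepsilon_{S,r}=-1$ if $|\{s\in S:s<r\}|$ is odd, $+1$ otherwise. The differential is $\bigoplus_{|S|=i,\,r\notin S}\varepsilon_{S,r}d_{S,r}$. Its homology in homological degree $i$ is $H_d^i(\mathcal H)$. *)

(* Defs.v *)
From HB Require Import structures.
From mathcomp Require Import freeg boolp.
From mathcomp Require Import all_boot all_order all_algebra.

Set Implicit Arguments.
Unset Strict Implicit.
Unset Printing Implicit Defensive.

Import GRing.Theory.
Local Open Scope ring_scope.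
Local Open Scope quotient_scope.

Section QuotientModule.
Variables (K : fieldType) (V : lmodType K) (S : submodClosed V).

(* A submodClosed predicate is not canonically closed under opposite. *)
Definition opp_closed_pred : {pred V} := fun v => v \in S.

Lemma opp_closed_pred_zmod : zmod_closed opp_closed_pred.
Proof.
split=> [|u v uS vS]; first exact: (rpred0 S).
by rewrite unfold_in -scaleN1r (rpredD, rpredZ) // rpredZ.
Qed.

HB.instance Definition _ :=
  GRing.isZmodClosed.Build V opp_closed_pred opp_closed_pred_zmod.

Definition quotmod : Type := Quotient.quot opp_closed_pred.

HB.instance Definition _ := GRing.Zmodule.on quotmod.

Definition quot_class (v : V) : quotmod := \pi_(Quotient.quot opp_closed_pred) v.

Lemma quot_class_is_zmod_morphism : zmod_morphism quot_class.
Proof. exact: raddfB. Qed.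

Lemma quot_classW (q : quotmod) : exists v, quot_class v = q.
Proof. by exists (repr (q : Quotient.quot opp_closed_pred)); rewrite /quot_class reprK. Qed.

Lemma quot_class_eq0 v : (quot_class v = 0) <-> (v \in S).
Proof.
have -> : (0 : quotmod) = quot_class 0.
  by rewrite -[X in quot_class X](subrr (0 : V)) quot_class_is_zmod_morphism subrr.
rewrite /quot_class; split=> [/eqP|vS].
  by rewrite -Quotient.idealrBE subr0.
by apply/eqP; rewrite -Quotient.idealrBE subr0.
Qed.

Lemma quot_class_eq u v : (quot_class u = quot_class v) <-> (u - v \in S).
Proof.
rewrite -quot_class_eq0 quot_class_is_zmod_morphism.
by split=> [->|/eqP]; rewrite ?subrr // subr_eq0 => /eqP.
Qed.

Definition quot_scale (a : K) (q : quotmod) : quotmod :=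
  quot_class (a *: repr (q : Quotient.quot opp_closed_pred)).

Lemma quot_scaleE a v : quot_scale a (quot_class v) = quot_class (a *: v).
Proof.
apply/quot_class_eq; rewrite -scalerBr rpredZ //.
by apply/quot_class_eq; rewrite /quot_class reprK.
Qed.

Lemma quot_scaleA a b q : quot_scale a (quot_scale b q) = quot_scale (a * b) q.
Proof. by have [v <-] := quot_classW q; rewrite !quot_scaleE scalerA. Qed.
Lemma quot_scale1 : left_id 1 quot_scale.
Proof. by move=> q; have [v <-] := quot_classW q; rewrite !quot_scaleE scale1r. Qed.
Lemma quot_classD u v : quot_class (u + v) = quot_class u + quot_class v.
Proof.
have qB := quot_class_is_zmod_morphism.
by rewrite -[v in LHS]opprK qB -[- v]sub0r qB -(subrr v) qB subrr sub0r opprK.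
Qed.
Lemma quot_scaleDr : right_distributive quot_scale +%R.
Proof.
move=> a p q; have [u <-] := quot_classW p; have [v <-] := quot_classW q.
by rewrite -quot_classD !quot_scaleE -quot_classD scalerDr.
Qed.
Lemma quot_scaleDl q : {morph quot_scale^~ q : a b / a + b}.
Proof.
move=> a b; have [v <-] := quot_classW q.
by rewrite !quot_scaleE -quot_classD scalerDl.
Qed.

HB.instance Definition _ := GRing.Zmodule_isLmodule.Build K quotmod
  quot_scaleA quot_scale1 quot_scaleDr quot_scaleDl.

Lemma quot_class_is_scalable : scalable quot_class.
Proof. by move=> a v; rewrite -quot_scaleE. Qed.

HB.instance Definition _ := GRing.isZmodMorphism.Build V quotmod quot_class
  quot_class_is_zmod_morphism.
HB.instance Definition _ := GRing.isScalable.Build K V quotmod *:%R quot_class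
  quot_class_is_scalable.

Section Lift.
Variables (M : lmodType K) (f : {linear V -> M}).
Hypothesis fS : forall v, v \in S -> f v = 0.

Definition quot_lift of (forall v, v \in S -> f v = 0) :=
  fun q : quotmod => f (repr (q : Quotient.quot opp_closed_pred)).

Lemma quot_liftE v : quot_lift fS (quot_class v) = f v.
Proof.
apply/eqP; rewrite -subr_eq0 -linearB; apply/eqP/fS/quot_class_eq.
by rewrite /quot_class reprK.
Qed.

Lemma quot_lift_is_linear : linear (quot_lift fS).
Proof.
move=> a p q; have [u <-] := quot_classW p; have [v <-] := quot_classW q.
by rewrite -linearP !quot_liftE linearP.
Qed.

HB.instance Definition _ := GRing.isLinear.Build K quotmod M *:%R
  (quot_lift fS) quot_lift_is_linear.
End Lift.
End QuotientModule.

Section Span.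
Variables (K : fieldType) (V : lmodType K) (G : V -> Prop).

Definition span_pred : {pred V} :=
  fun v => `[< forall S : submodClosed V, (forall g, G g -> g \in S) -> v \in S >].

Lemma span_predP v : reflect
  (forall S : submodClosed V, (forall g, G g -> g \in S) -> v \in S)
  (v \in span_pred).
Proof. exact: asboolP. Qed.

Lemma span_pred_closed : submod_closed span_pred.
Proof.
split=> [|a u v /span_predP uS /span_predP vS].
  by apply/span_predP=> S _; exact: rpred0.
by apply/span_predP=> S GS; rewrite rpredD ?rpredZ ?uS ?vS.
Qed.

HB.instance Definition _ :=
  GRing.isSubmodClosed.Build K V span_pred span_pred_closed.

Lemma mem_span g : G g -> g \in span_pred.
Proof. by move=> Gg; apply/span_predP=> S; apply. Qed.
End Span.

Section KernelImage.
Variables (K : fieldType) (U V : lmodType K) (f : {linear U -> V}).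

Definition ker_pred : {pred U} := fun u => f u == 0.
Lemma ker_pred_closed : submod_closed ker_pred.
Proof.
split=> [|a u v]; rewrite !unfold_in ?linear0 // => /eqP fu /eqP fv.
by rewrite linearP fu fv scaler0 addr0.
Qed.
HB.instance Definition _ :=
  GRing.isSubmodClosed.Build K U ker_pred ker_pred_closed.

Lemma ker_predE u : (u \in ker_pred) = (f u == 0). Proof. by []. Qed.

Definition kernel : Type := {u : U | u \in ker_pred}.
HB.instance Definition _ := SubChoice.on kernel.
HB.instance Definition _ := [SubChoice_isSubLmodule of kernel by <:].
End KernelImage.

Section DirectSum.
Variables (K : fieldType) (I : eqType) (M : I -> lmodType K).

Definition dprod : Type := forall i, M i.

HB.instance Definition _ := Choice.copy dprod (forall i, M i).

Implicit Types x y z : dprod.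

Definition dprod_zero : dprod := fun=> 0.
Definition dprod_opp x : dprod := fun i => - x i.
Definition dprod_add x y : dprod := fun i => x i + y i.
Definition dprod_scale (a : K) x : dprod := fun i => a *: x i.

Lemma dprod_addA : associative dprod_add.
Proof. by move=> x y z; apply: functional_extensionality_dep => i; exact: addrA. Qed.
Lemma dprod_addC : commutative dprod_add.
Proof. by move=> x y; apply: functional_extensionality_dep => i; exact: addrC. Qed.
Lemma dprod_add0 : left_id dprod_zero dprod_add.
Proof. by move=> x; apply: functional_extensionality_dep => i; exact: add0r. Qed.
Lemma dprod_addN : left_inverse dprod_zero dprod_opp dprod_add.
Proof. by move=> x; apply: functional_extensionality_dep => i; exact: addNr. Qed.

HB.instance Definition _ := GRing.isZmodule.Build dprod
  dprod_addA dprod_addC dprod_add0 dprod_addN.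

Lemma dprod_scaleA a b x :
  dprod_scale a (dprod_scale b x) = dprod_scale (a * b) x.
Proof. by apply: functional_extensionality_dep => i; exact: scalerA. Qed.
Lemma dprod_scale1 : left_id 1 dprod_scale.
Proof. by move=> x; apply: functional_extensionality_dep => i; exact: scale1r. Qed.
Lemma dprod_scaleDr : right_distributive dprod_scale +%R.
Proof.
by move=> a x y; apply: functional_extensionality_dep => i; exact: scalerDr.
Qed.
Lemma dprod_scaleDl x : {morph dprod_scale^~ x : a b / a + b}.
Proof.
by move=> a b; apply: functional_extensionality_dep => i; exact: scalerDl.
Qed.

HB.instance Definition _ := GRing.Zmodule_isLmodule.Build K dprod
  dprod_scaleA dprod_scale1 dprod_scaleDr dprod_scaleDl.

Lemma dprodP x y : (forall i, x i = y i) -> x = y.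
Proof. exact: functional_extensionality_dep. Qed.
Lemma dprod0E i : (0 : dprod) i = 0. Proof. by []. Qed.
Lemma dprodDE x y i : (x + y) i = x i + y i. Proof. by []. Qed.
Lemma dprodZE a x i : (a *: x) i = a *: x i. Proof. by []. Qed.

Definition finsupp_pred : {pred dprod} :=
  fun x => `[< exists s : seq I, forall i, i \notin s -> x i = 0 >].

Lemma finsupp_predP x : reflect
  (exists s : seq I, forall i, i \notin s -> x i = 0) (x \in finsupp_pred).
Proof. exact: asboolP. Qed.

Lemma finsupp_pred_closed : submod_closed finsupp_pred.
Proof.
split=> [|a x y /finsupp_predP[s xs] /finsupp_predP[t yt]]; apply/finsupp_predP.
  by exists [::].
exists (s ++ t) => i; rewrite mem_cat negb_or => /andP[/xs xi0 /yt yi0].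
by rewrite dprodDE dprodZE xi0 yi0 scaler0 addr0.
Qed.

HB.instance Definition _ :=
  GRing.isSubmodClosed.Build K dprod finsupp_pred finsupp_pred_closed.

Definition dsum : Type := {x : dprod | x \in finsupp_pred}.
HB.instance Definition _ := SubChoice.on dsum.
HB.instance Definition _ := [SubChoice_isSubLmodule of dsum by <:].
End DirectSum.

Section DirectSumMap.
Variables (K : fieldType) (I : eqType) (M N : I -> lmodType K).
Variable f : forall i, {linear M i -> N i}.

Definition dprod_map (x : dprod M) : dprod N := fun i => f i (x i).

Lemma dprod_map_finsupp (x : dsum M) :
  dprod_map (val x) \in finsupp_pred (M := N).
Proof.
have /finsupp_predP[s xs] := valP x.
by apply/finsupp_predP; exists s => i /xs xi0; rewrite /dprod_map xi0 linear0.
Qed.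

Definition dsum_map (x : dsum M) : dsum N :=
  exist (fun y => y \in finsupp_pred (M := N)) _ (dprod_map_finsupp x).

Lemma dsum_mapE x i : val (dsum_map x) i = f i (val x i). Proof. by []. Qed.

Lemma dsum_map_is_linear : linear dsum_map.
Proof. by move=> a x y; apply/val_inj/dprodP => i; exact: linearP. Qed.

HB.instance Definition _ := GRing.isLinear.Build K (dsum M) (dsum N) *:%R
  dsum_map dsum_map_is_linear.
End DirectSumMap.

Section ExteriorPower.
Variables (K : fieldType) (j : nat).

Section Def.
Variable W : lmodType K.
Local Notation tup := {ffun 'I_j -> W}.

Definition subst_at (t : tup) (k : 'I_j) (w : W) : tup :=
  [ffun i => if i == k then w else t i].

(* The exterior power is the free module on W^j modulo multilinearity and
   alternation. *)
Inductive ext_rel : {freeg tup / K} -> Prop :=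
| ExtLinear (t : tup) (k : 'I_j) (a : K) (u v : W) : ext_rel
    (<< subst_at t k (a *: u + v) >> - a *: << subst_at t k u >>
      - << subst_at t k v >>)
| ExtAlternate (t : tup) (k k' : 'I_j) : k != k' -> t k = t k' ->
    ext_rel << t >>.

Definition ext : lmodType K := quotmod (span_pred ext_rel).

Definition wedge (t : tup) : ext :=
  @quot_class K {freeg tup / K} (span_pred ext_rel) << t >>.

Definition alternating (M : lmodType K) (F : tup -> M) :=
  (forall (t : tup) (k : 'I_j) (a : K) (u v : W), F (subst_at t k (a *: u + v)) =
     a *: F (subst_at t k u) + F (subst_at t k v)) /\
  (forall (t : tup) (k k' : 'I_j), k != k' -> t k = t k' -> F t = 0).

Lemma wedge_alternating : alternating wedge.
Proof.
rewrite /wedge; split=> [t k a u v|t k k' kk' tkk'].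
  apply/eqP; rewrite -subr_eq0 opprD addrA -linearZ -!linearB; apply/eqP.
  by apply/quot_class_eq0/mem_span; constructor.
by apply/quot_class_eq0/mem_span; apply: ExtAlternate tkk'.
Qed.

Section Universal.
Variables (M : lmodType K) (F : tup -> M).

Lemma fglift_is_linear : linear (fglift F).
Proof.
have liftB := lift_is_additive F.
have lift0 : fglift F 0 = 0 by rewrite -[in LHS](subrr 0) liftB subrr.
have liftN D : fglift F (- D) = - fglift F D by rewrite -sub0r liftB lift0 sub0r.
have liftD D D' : fglift F (D + D') = fglift F D + fglift F D'.
  by rewrite -[D' in LHS]opprK liftB liftN opprK.
have lift_sum (s : seq tup) (c : tup -> K) :
    fglift F (\sum_(t <- s) << c t *g t >>) = \sum_(t <- s) c t *: F t.
  elim: s => [|t s IHs]; first by rewrite !big_nil.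
  by rewrite !big_cons liftD IHs liftU.
move=> a D D'; rewrite liftD; congr (_ + _).
have -> : fglift F (a *: D) = \sum_(t <- dom D) (a * coeff t D) *: F t.
  exact: lift_sum.
rewrite -[in RHS](freeg_sumE D) lift_sum scaler_sumr.
by apply: eq_bigr => t _; rewrite scalerA.
Qed.

HB.instance Definition _ := GRing.isLinear.Build K {freeg tup / K} M *:%R
  (fglift F) fglift_is_linear.

Hypothesis altF : alternating F.

Lemma fglift_ext_rel D : D \in span_pred ext_rel -> fglift F D = 0.
Proof.
move=> /span_predP/(_ (ker_pred (fglift F) : submodClosed _)) kerD.
apply/eqP; rewrite -ker_predE; apply: kerD => _ [t k a u v|t k k' kk' tkk'].
  rewrite ker_predE !linearB /= linearZ /= !liftU !scale1r altF.1.
  by rewrite addrAC addrK subrr.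
by rewrite ker_predE /= liftU (altF.2 _ _ _ kk' tkk') scaler0.
Qed.

Definition ext_lift : {linear ext -> M} := quot_lift fglift_ext_rel.

Lemma ext_liftE t : ext_lift (wedge t) = F t.
Proof.
by rewrite -[RHS]scale1r -liftU; exact: (quot_liftE fglift_ext_rel << t >>).
Qed.
End Universal.

Lemma ext_lift_unique (M : lmodType K) (f g : {linear ext -> M}) :
  (forall t, f (wedge t) = g (wedge t)) -> f =1 g.
Proof.
move=> fg q; have [D <-] := quot_classW q.
rewrite -[D]freeg_sumE !linear_sum; apply: eq_bigr => t _.
have -> : << coeff t D *g t >> = coeff t D *: << t >> :> {freeg tup / K}.
  apply/eqP/freeg_eqP => s.
  by rewrite coeffZ !coeffU mul1r.
by rewrite !linearZ /=; congr (_ *: _); exact: fg.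
Qed.
End Def.

Section Map.
Variables (U W : lmodType K) (f : {linear U -> W}).

Lemma ext_map_alternating : alternating (fun t => wedge [ffun i => f (t i)]).
Proof.
have fS t k w : [ffun i => f (subst_at t k w i)] =
    subst_at [ffun i => f (t i)] k (f w).
  by apply/ffunP=> i; rewrite !ffunE; case: ifP.
split=> [t k a u v|t k k' kk' tkk'].
  by rewrite !fS linearP (wedge_alternating W).1.
by apply: ((wedge_alternating W).2 _ _ _ kk'); rewrite !ffunE tkk'.
Qed.

Definition ext_map : {linear ext U -> ext W} := ext_lift ext_map_alternating.

Lemma ext_map_wedge t : ext_map (wedge t) = wedge [ffun i => f (t i)].
Proof. exact: ext_liftE. Qed.
End Map.

Lemma ext_map_comp (U W X : lmodType K) (f : {linear U -> W})
    (g : {linear W -> X}) (h : {linear U -> X}) :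
  (forall u, g (f u) = h u) -> forall q, ext_map g (ext_map f q) = ext_map h q.
Proof.
move=> gf; apply: (@ext_lift_unique _ _ (ext_map g \o ext_map f) _) => t /=.
apply: etrans (congr1 (ext_map g) (ext_map_wedge f t)) _.
apply: etrans (ext_map_wedge g _) (etrans _ (esym (ext_map_wedge h t))).
by congr wedge; apply/ffunP=> i; rewrite !ffunE gf.
Qed.
End ExteriorPower.

Arguments ext : simpl never.
Arguments ext_map : simpl never.

Section Complexes.
Variable K : fieldType.

(* The differential is a total family indexed by pairs of degrees, supported on
   the pairs (i, i + 1); this avoids transports along i - 1 + 1 = i. *)
Record complex := Complex {
  cobj :> int -> lmodType K;
  cdiff : forall i i', {linear cobj i -> cobj i'};
  cdiff_degree : forall i i' x, i' != i + 1 -> cdiff i i' x = 0;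
  cdiff_square : forall i i' i'' x, cdiff i' i'' (cdiff i i' x) = 0
}.

Section Homology.
Variables (C : complex) (i : int).

Definition cycle := kernel (cdiff C i (i + 1)).

Definition boundary_pred : {pred cycle} :=
  fun z => `[< exists y, cdiff C (i - 1) i y = val z >].

Lemma boundary_predP (z : cycle) : reflect
  (exists y, cdiff C (i - 1) i y = val z) (z \in boundary_pred).
Proof. exact: asboolP. Qed.

Lemma boundary_pred_closed : submod_closed boundary_pred.
Proof.
split=> [|a u v /boundary_predP[x xu] /boundary_predP[y yv]].
  by apply/boundary_predP; exists 0; rewrite linear0.
by apply/boundary_predP; exists (a *: x + y); rewrite linearP xu yv.
Qed.

HB.instance Definition _ :=
  GRing.isSubmodClosed.Build K cycle boundary_pred boundary_pred_closed.

Definition homology : lmodType K := quotmod boundary_pred.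
Definition homology_class : {linear cycle -> homology} :=
  @quot_class K cycle boundary_pred.

Lemma homology_classW (q : homology) : exists z, homology_class z = q.
Proof. exact: quot_classW. Qed.

Lemma homology_class_eq0 z : homology_class z = 0 <->
  exists y, cdiff C (i - 1) i y = val z.
Proof.
by split=> [/quot_class_eq0/boundary_predP|/boundary_predP/quot_class_eq0].
Qed.
End Homology.

(* Chain map of degree p : A -> B, strictly commuting with the differentials. *)
Record chain_map (p : int) (A B : complex) := ChainMap {
  cmap :> forall i i', {linear A i -> B i'};
  cmap_degree : forall i i' x, i' != i + p -> cmap i i' x = 0;
  cmap_diff : forall i i' x, cmap (i + 1) (i' + 1) (cdiff A i (i + 1) x) =
    cdiff B i' (i' + 1) (cmap i i' x)
}.

Section HomologyMap.
Variables (p : int) (A B : complex) (f : chain_map p A B) (i i' : int).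

Lemma cycle_map_subproof (z : cycle A i) :
  f i i' (val z) \in ker_pred (cdiff B i' (i' + 1)).
Proof.
by rewrite ker_predE -cmap_diff (eqP (valP z)) linear0.
Qed.

Definition cycle_map (z : cycle A i) : cycle B i' :=
  exist (fun y => y \in ker_pred (cdiff B i' (i' + 1))) _ (cycle_map_subproof z).

Lemma cycle_map_is_linear : linear cycle_map.
Proof. by move=> a x y; apply: val_inj; exact: linearP. Qed.

HB.instance Definition _ := GRing.isLinear.Build K (cycle A i) (cycle B i') *:%R
  cycle_map cycle_map_is_linear.

Lemma cycle_map_boundary z : z \in @boundary_pred A i ->
  @homology_class B i' (cycle_map z) = 0.
Proof.
move=> /boundary_predP[y yz]; apply/homology_class_eq0.
have cmapB k k' k1 k1' x : k1 = k + 1 -> k1' = k' + 1 ->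
    f k1 k1' (cdiff A k k1 x) = cdiff B k' k1' (f k k' x).
  by move=> -> ->; exact: cmap_diff.
by exists (f (i - 1) (i' - 1) y); rewrite -(cmapB (i - 1) (i' - 1) i i') ?subrK // yz.
Qed.

Definition homology_map : {linear homology A i -> homology B i'} :=
  quot_lift (f := @homology_class B i' \o cycle_map) cycle_map_boundary.

Lemma homology_mapE z :
  homology_map (homology_class A i z) = homology_class B i' (cycle_map z).
Proof.
exact: (@quot_liftE K (cycle A i) (@boundary_pred A i) _
  (@homology_class B i' \o cycle_map) cycle_map_boundary z).
Qed.
End HomologyMap.

Definition exact_at (X Y Z : lmodType K) (f : {linear X -> Y})
    (g : {linear Y -> Z}) :=
  forall y, g y = 0 <-> exists x, f x = y.

Section ExactSequences.
Variables (A B C : complex) (iota : chain_map 1 A B) (pi : chain_map 0 B C).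

(* 0 -> A^(i-1) -> B^i -> C^i -> 0 *)
Definition short_exact := forall i : int,
  [/\ injective (iota (i - 1) i),
      exact_at (iota (i - 1) i) (pi i i)
    & forall z, exists y, pi i i y = z].

Definition connecting_map
    (delta : forall i, {linear homology C i -> homology A i}) :=
  forall i (z : cycle C i) (y : B i) (x : cycle A i),
    pi i i y = val z -> iota i (i + 1) (val x) = cdiff B i (i + 1) y ->
    delta i (homology_class C i z) = homology_class A i x.

(* 0 -> ... -> H^(i-1)(A) -> H^i(B) -> H^i(C) -> H^i(A) -> ...
   Injectivity in degree 0 is the initial zero, the complexes of interest
   vanishing in negative degrees. *)
Definition long_exact
    (delta : forall i, {linear homology C i -> homology A i}) :=
  injective (homology_map pi 0 0) /\
  forall i : int,
    [/\ exact_at (homology_map iota (i - 1) i) (homology_map pi i i),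
        exact_at (homology_map pi i i) (delta i)
      & exact_at (delta i) (homology_map iota i (i + 1))].
End ExactSequences.

Section DirectSumComplex.
Variables (I : eqType).

Section Object.
Variable C : I -> complex.

Definition csum_diff i i' :
    {linear dsum (fun j => C j i) -> dsum (fun j => C j i')} :=
  dsum_map (fun j => cdiff (C j) i i').

Lemma csum_diff_degree i i' x : i' != i + 1 -> csum_diff i i' x = 0.
Proof. by move=> ii'; apply/val_inj/dprodP => j; exact: cdiff_degree. Qed.

Lemma csum_diff_square i i' i'' x : csum_diff i' i'' (csum_diff i i' x) = 0.
Proof. by apply/val_inj/dprodP => j; exact: cdiff_square. Qed.

Definition csum := Complex csum_diff_degree csum_diff_square.
End Object.

Variables (p : int) (A B : I -> complex) (f : forall j, chain_map p (A j) (B j)).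

Definition csum_map_fun i i' : {linear csum A i -> csum B i'} :=
  dsum_map (fun j => f j i i').

Lemma csum_map_degree i i' x : i' != i + p -> csum_map_fun i i' x = 0.
Proof. by move=> ii'; apply/val_inj/dprodP => j; exact: cmap_degree. Qed.

Lemma csum_map_diff i i' x :
  csum_map_fun (i + 1) (i' + 1) (cdiff (csum A) i (i + 1) x) =
  cdiff (csum B) i' (i' + 1) (csum_map_fun i i' x).
Proof. by apply/val_inj/dprodP => j; exact: cmap_diff. Qed.

Definition csum_map : chain_map p (csum A) (csum B) :=
  ChainMap csum_map_degree csum_map_diff.
End DirectSumComplex.
End Complexes.

Section OrthogonalProjection.
Variables (K : fieldType) (V : vectType K) (form : {symmetric V}).
Implicit Types W : {vspace V}.

Definition nondegenerate_on W := (W :&: orthov form W = 0)%VS.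

Definition orth_proj W : 'End(V) := daddv_pi W (orthov form W).

Lemma formC u v : form u v = form v u.
Proof. by rewrite hermC expr0 mul1r. Qed.

Lemma mem_orth1 u v : (u \in orthov form <[v]>%VS) = (form v u == 0).
Proof. by rewrite mem_orthov1 formC. Qed.

Lemma nondegenerate_onP W : nondegenerate_on W <->
  (forall u, u \in W -> {in W, forall v, form u v = 0} -> u = 0).
Proof.
split=> [W0 u uW uorth|W0].
  apply/eqP; rewrite -memv0 -W0 memv_cap uW; exact/mem_orthovP.
apply/eqP; rewrite -subv0; apply/subvP=> u; rewrite memv_cap => /andP[uW].
by move=> /mem_orthovP uorth; rewrite memv0; apply/eqP/W0.
Qed.

Lemma orthov_sum W : nondegenerate_on W -> (W + orthov form W = fullv)%VS.
Proof.
move=> W0; apply/eqP; rewrite eqEdim subvf /= dimv_disjoint_sum //.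
pose F (v : V) : {ffun 'I_(\dim W) -> K^o} := [ffun i : 'I__ => form (vbasis W)`_i v].
have F_lin : linear F.
  by move=> a u v; apply/ffunP=> i; rewrite !ffunE linearPr.
pose FL := GRing.isLinear.Build K V {ffun 'I_(\dim W) -> K^o} *:%R F F_lin.
pose f : 'Hom(V, {ffun 'I_(\dim W) -> K^o}) :=
  linfun (HB.pack_for {linear V -> {ffun 'I_(\dim W) -> K^o}} F FL).
have fE v : f v = F v by rewrite lfunE.
have kerf : (lker f <= orthov form W)%VS.
  apply/subvP=> v; rewrite memv_ker fE => /eqP/ffunP Fv0.
  apply/mem_orthovP=> w wW; rewrite (coord_vbasis wW) linear_sumr big1 // => i _.
  have := Fv0 i; rewrite !ffunE linearZr /= formC => ->.
  by rewrite mulr0.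
rewrite -(limg_ker_dim f fullv) capfv addnC leq_add ?dimvS //.
apply: leq_trans (dimvS (subvf _)) _.
by rewrite dimvf /dim /= card_ord muln1.
Qed.

Lemma orth_proj_mem W v : orth_proj W v \in W.
Proof. exact: memv_pi. Qed.

Lemma orth_proj_id W v : nondegenerate_on W -> v \in W -> orth_proj W v = v.
Proof. exact: daddv_pi_id. Qed.

Lemma orth_projP W v : nondegenerate_on W ->
  {in W, forall w, form w (v - orth_proj W v) = 0}.
Proof.
move=> W0 w wW; have vf : v \in (W + orthov form W)%VS.
  by rewrite orthov_sum ?memvf.
rewrite -{1}(daddv_pi_add W0 vf) addrC addKr formC.
by have /mem_orthovP-> := memv_pi (orthov form W) W v.
Qed.

Lemma orth_proj_unique W v u : nondegenerate_on W -> u \in W ->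
  {in W, forall w, form w (v - u) = 0} -> orth_proj W v = u.
Proof.
move=> W0 uW uP; apply/eqP; rewrite -subr_eq0; apply/eqP.
move/nondegenerate_onP: (W0); apply; first by rewrite rpredB ?orth_proj_mem.
move=> w wW; rewrite formC.
have -> : orth_proj W v - u = (v - u) - (v - orth_proj W v).
  by rewrite opprB [RHS]addrC addrA subrK.
by rewrite linearBr /= uP // orth_projP // subrr.
Qed.

Lemma orth_proj_comp W W' v : nondegenerate_on W -> nondegenerate_on W' ->
  (W <= W')%VS -> orth_proj W (orth_proj W' v) = orth_proj W v.
Proof.
move=> W0 W'0 WW'; apply/esym/orth_proj_unique; rewrite ?orth_proj_mem // => w wW.
rewrite -[v](subrK (orth_proj W' v)) -addrA linearDr /= orth_projP //.
  by rewrite add0r subrK orth_projP.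
exact: subvP wW.
Qed.
End OrthogonalProjection.

Section RestrictedForm.
Variables (K : fieldType) (V : vectType K) (form : {symmetric V}).
Variable W : {vspace V}.

Definition restr_form (u v : subvs_of W) : K := form (vsval u) (vsval v).

Lemma restr_form_bilinear : bilinear_for *%R (idfun \; *%R) restr_form.
Proof.
by split=> [w a u v|w a u v]; rewrite /restr_form linearP ?linearPl ?linearPr.
Qed.
HB.instance Definition _ := bilinear_isBilinear.Build K
  (subvs_of W) (subvs_of W) K *%R (idfun \; *%R) restr_form restr_form_bilinear.

Lemma restr_form_sym u v : restr_form u v = (-1) ^+ false * idfun (restr_form v u).
Proof. exact: hermC. Qed.
HB.instance Definition _ := isHermitianSesquilinear.Build K (subvs_of W)
  false idfun restr_form restr_form_sym.

Definition restr_inner : {symmetric (subvs_of W)} := restr_form.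
End RestrictedForm.

Section Arrangements.
Variable K : fieldType.

Definition flat_of n (V : vectType K) (H : 'I_n -> {vspace V}) (S : {set 'I_n}) :=
  (\bigcap_(s in S) H s)%VS.

Lemma mem_flat_of n (V : vectType K) (H : 'I_n -> {vspace V}) S v :
  (v \in flat_of H S) <-> (forall s, s \in S -> v \in H s).
Proof. by rewrite memvE; split=> [/subv_bigcapP|?]; last exact/subv_bigcapP. Qed.

(* Over a general field an inner product is a symmetric bilinear form. The
   subspaces onto which one projects are the flats, on which it is required
   to be nondegenerate; nondegeneracy on V itself is the case S = set0. *)
Record vector_arrangement (n : nat) := VectorArrangement {
  va_space : vectType K;
  va_form : {symmetric va_space};
  va_vec : 'I_n -> va_space;
  va_nondeg : forall S : {set 'I_n}, nondegenerate_on va_form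
    (flat_of (fun i => orthov va_form <[va_vec i]>%VS) S)
}.

(* The data of a hyperplane arrangement used by the chain complex; that the
   arr_hyp are of the form nu^perp (possibly V) is recorded by hyperplanes. *)
Record arrangement (n : nat) := Arrangement {
  arr_space : vectType K;
  arr_form : {symmetric arr_space};
  arr_hyp : 'I_n -> {vspace arr_space};
  arr_nondeg : forall S : {set 'I_n}, nondegenerate_on arr_form (flat_of arr_hyp S)
}.

Definition hyperplanes n (A : vector_arrangement n) : arrangement n :=
  Arrangement (@va_nondeg n A).

Definition flat n (A : arrangement n) (S : {set 'I_n}) : {vspace arr_space A} :=
  flat_of (@arr_hyp n A) S.

Section DeletionRestriction.
Variables (n : nat) (A : arrangement n) (l : 'I_n).

(* lift l : 'I_n.-1 -> 'I_n is the increasing bijection onto the complement of l. *)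
Lemma flat_lift S :
  flat_of (fun i => arr_hyp A (lift l i)) S = flat A (lift l @: S).
Proof.
apply/vspaceP=> v; apply/idP/idP => /mem_flat_of vS; apply/mem_flat_of.
  by move=> _ /imsetP[s sS ->]; exact: vS.
by move=> s sS; apply: vS; exact: imset_f.
Qed.

Lemma deletion_nondeg S :
  nondegenerate_on (arr_form A) (flat_of (fun i => arr_hyp A (lift l i)) S).
Proof. by rewrite flat_lift; exact: arr_nondeg. Qed.

Definition deletion : arrangement n.-1 := Arrangement deletion_nondeg.

Local Notation Hl := (arr_hyp A l).

(* H_i :&: H_l as a subspace of H_l *)
Definition restr_hyp (i : 'I_n.-1) : {vspace subvs_of Hl} :=
  (linfun vsval @^-1: arr_hyp A (lift l i))%VS.

Lemma mem_restr_flat S (u : subvs_of Hl) :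
  (u \in flat_of restr_hyp S) = (vsval u \in flat A (l |: lift l @: S)).
Proof.
apply/idP/idP => /mem_flat_of uS; apply/mem_flat_of.
  move=> s /setU1P[-> | /imsetP[i iS ->]]; first exact: subvsP.
  by have := uS i iS; rewrite -memv_preim lfunE.
move=> i iS; rewrite -memv_preim lfunE; apply: uS.
by rewrite setU1r ?imset_f.
Qed.

Lemma restriction_nondeg S :
  nondegenerate_on (restr_inner (arr_form A) Hl) (flat_of restr_hyp S).
Proof.
have /nondegenerate_onP Anondeg := @arr_nondeg n A (l |: lift l @: S).
apply/nondegenerate_onP=> u uS uorth; apply/val_inj/Anondeg.
  by rewrite -[flat_of _ _]/(flat A _) -mem_restr_flat.
move=> v vS.
have vHl : v \in Hl by apply: (mem_flat_of _ _ _).1 vS _ _; exact: setU11.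
rewrite -[v](vsprojK vHl); apply: uorth.
by rewrite mem_restr_flat vsprojK.
Qed.

Definition restriction : arrangement n.-1 := Arrangement restriction_nondeg.
End DeletionRestriction.

Section VectorRestriction.
Variables (n : nat) (A : vector_arrangement n) (l : 'I_n).
Local Notation Hl := (arr_hyp (hyperplanes A) l).

Definition restr_vec (i : 'I_n.-1) : subvs_of Hl :=
  vsproj Hl (orth_proj (va_form A) Hl (va_vec A (lift l i))).

(* The restriction is the arrangement of the projected vectors. *)
Lemma restr_vecE i : orthov (restr_inner (va_form A) Hl) <[restr_vec i]>%VS =
  arr_hyp (restriction (hyperplanes A) l) i.
Proof.
have Hl0 : nondegenerate_on (va_form A) Hl.
  have -> : Hl = flat_of (arr_hyp (hyperplanes A)) [set l].
    apply/vspaceP=> v; apply/idP/idP=> [vl|/mem_flat_of]; last by apply; exact: set11.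
    by apply/mem_flat_of=> s /set1P->.
  exact: va_nondeg.
apply/vspaceP=> u; rewrite -memv_preim lfunE /= !mem_orth1.
rewrite /restr_inner /= /restr_form vsprojK ?orth_proj_mem // formC [in RHS]formC.
have := orth_projP (va_vec A (lift l i)) Hl0 (subvsP u).
by rewrite linearBr /= => /eqP; rewrite subr_eq0 => /eqP->.
Qed.
End VectorRestriction.

Section ChainComplex.
Variables (n : nat) (A : arrangement n) (j : nat).
Implicit Types S T : {set 'I_n}.

(* The sign is -1 exactly when the number of s in S below r is odd. *)
Definition eps S (r : 'I_n) : K := (-1) ^+ #|[set s in S | (s < r)%N]|.

(* For T containing S this is the orthogonal projection H_S -> H_T. *)
Definition flat_proj S T : {linear subvs_of (flat A S) -> subvs_of (flat A T)} :=
  vsproj (flat A T) \o orth_proj (arr_form A) (flat A T) \o vsval.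

Definition d_part S T : {linear ext j (subvs_of (flat A S)) ->
    ext j (subvs_of (flat A T))} :=
  ext_map j (flat_proj S T).

Definition index_set (i : int) := {S : {set 'I_n} | #|S|%:Z == i}.

(* The direct sum over this finite index set is the product; it is zero for
   negative i. *)
Definition Cd_obj (i : int) : lmodType K :=
  dprod (fun S : index_set i => ext j (subvs_of (flat A (sval S)))).

Definition Cd_diff_fun (i i' : int) (x : Cd_obj i) : Cd_obj i' :=
  fun T : index_set i' =>
  \sum_(S : index_set i)
    \sum_(r | (r \notin sval S) && (sval T == r |: sval S))
      eps (sval S) r *: d_part (sval S) (sval T) (x S).

Lemma Cd_diff_is_linear i i' : linear (@Cd_diff_fun i i').
Proof.
move=> a x y; apply: dprodP => T; rewrite dprodDE dprodZE /Cd_diff_fun.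
rewrite scaler_sumr -big_split; apply: eq_bigr => S _.
rewrite scaler_sumr -big_split; apply: eq_bigr => r _.
by rewrite dprodDE dprodZE linearP [RHS]addrC scalerDr addrC !scalerA mulrC.
Qed.

HB.instance Definition _ i i' := GRing.isLinear.Build K (Cd_obj i) (Cd_obj i')
  *:%R (@Cd_diff_fun i i') (@Cd_diff_is_linear i i').

Definition Cd_diff i i' : {linear Cd_obj i -> Cd_obj i'} := @Cd_diff_fun i i'.

Lemma Cd_diff_degree i i' x : i' != i + 1 -> Cd_diff i i' x = 0.
Proof.
move=> ii'; apply: dprodP => T; apply: big1 => S _; apply: big1 => r.
case/andP=> rS /eqP TS; case/eqP: ii'.
by rewrite -(eqP (svalP T)) -(eqP (svalP S)) TS cardsU1 rS addrC PoszD.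
Qed.

Lemma epsU1 S r t : r \notin S ->
  eps (r |: S) t = (-1) ^+ (r < t)%N * eps S t.
Proof.
move=> rS; rewrite /eps -exprD; congr (_ ^+ _).
have -> : [set s in r |: S | (s < t)%N] =
    if (r < t)%N then r |: [set s in S | (s < t)%N] else [set s in S | (s < t)%N].
  apply/setP=> s; case: ifP => rt; rewrite !inE.
    by have [->|] := eqVneq s r; rewrite ?rt.
  by have [->|] := eqVneq s r; rewrite ?rt ?andbF.
by case: ifP => _; rewrite ?cardsU1 ?inE ?(negbTE rS).
Qed.

Definition d_coef S T : K :=
  \sum_(r | (r \notin S) && (T == r |: S)) eps S r.

Lemma d_coef_square S T : \sum_(U : {set 'I_n}) d_coef S U * d_coef U T = 0.
Proof.
pose P r t := [&& r \notin S, t \notin r |: S & T == t |: (r |: S)].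
pose c r t : K := if P r t then eps S r * eps (r |: S) t else 0.
have -> : \sum_U d_coef S U * d_coef U T = \sum_r \sum_t c r t.
  transitivity (\sum_U \sum_r \sum_t
      if U == r |: S then c r t else 0).
    apply: eq_bigr => U _; rewrite big_distrl /= big_mkcond; apply: eq_bigr => r _.
    rewrite /c /P; have [rS|rS] /= := boolP (r \notin S); last first.
      by rewrite big1 // => t _; rewrite if_same.
    case: eqP => [->|_]; last by rewrite big1.
    by rewrite big_distrr /= big_mkcond.
  rewrite exchange_big; apply: eq_bigr => r _.
  rewrite exchange_big; apply: eq_bigr => t _.
  by rewrite -big_mkcond big_pred1_eq.
have cC (r t : 'I_n) : (r < t)%N -> c r t = - c t r.
  move=> rt; have rNt : r != t by rewrite neq_ltn rt.
  have PC : P r t = P t r.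
    rewrite /P (setUCA [set t]) !inE !negb_or [t == r]eq_sym rNt.
    by case: (r \in S); case: (t \in S).
  rewrite /c PC; case: ifP => [|_]; last by rewrite oppr0.
  rewrite -PC => /and3P[rS trS _].
  have tS : t \notin S by apply: contra trS; rewrite inE orbC => ->.
  rewrite !epsU1 // rt ltnNge (ltnW rt) /= expr1 expr0.
  by rewrite mulN1r mul1r mulrN mulrC.
have crr r : c r r = 0 by rewrite /c /P setU11 /= andbF.
have split_r r : \sum_t c r t =
    \sum_(t : 'I_n) (if (r < t)%N then c r t else 0) +
    \sum_(t : 'I_n) (if (t < r)%N then c r t else 0).
  rewrite -big_split; apply: eq_bigr => t _ /=.
  by case: ltngtP => [||/val_inj<-]; rewrite ?addr0 ?add0r ?crr.
rewrite (eq_bigr _ (fun r _ => split_r r)) big_split /=.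
rewrite [X in _ + X]exchange_big /= -big_split big1 // => r _ /=.
rewrite -big_split big1 // => t _ /=.
by case: ltnP => [/cC->|_]; rewrite ?addNr ?addr0.
Qed.

Lemma d_part_comp S T (U : {set 'I_n}) : T \subset U ->
  forall q, d_part T U (d_part S T q) = d_part S U q.
Proof.
move=> TU; apply: ext_map_comp => u; apply: val_inj => /=.
rewrite !vsprojK ?orth_proj_mem // orth_proj_comp //; try exact: arr_nondeg.
apply/subvP=> v /mem_flat_of vU; apply/mem_flat_of=> s /(subsetP TU).
exact: vU.
Qed.

Lemma Cd_diff_funE i i' (x : Cd_obj i) (T : index_set i') :
    Cd_diff_fun (i' := i') x T =
  \sum_(S : index_set i) d_coef (sval S) (sval T) *: d_part (sval S) (sval T) (x S).
Proof. by apply: eq_bigr => S _; rewrite scaler_suml. Qed.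

Lemma d_coef_neq0 S T : d_coef S T != 0 -> (S \subset T) && (#|T| == #|S|.+1).
Proof.
apply: contraNT => ST; apply/eqP/big1 => r /andP[rS /eqP TS].
by case/negP: ST; rewrite TS subsetUr cardsU1 rS add1n eqxx.
Qed.

Lemma Cd_diff_square i i' i'' x : Cd_diff i' i'' (Cd_diff i i' x) = 0.
Proof.
apply: dprodP => T; rewrite /Cd_diff /= Cd_diff_funE dprod0E.
transitivity (\sum_(S : index_set i)
    (\sum_(U : index_set i') d_coef (sval S) (sval U) * d_coef (sval U) (sval T))
      *: d_part (sval S) (sval T) (x S)).
  under [RHS]eq_bigr => S _ do rewrite scaler_suml.
  rewrite exchange_big; apply: eq_bigr => U _.
  rewrite Cd_diff_funE linear_sum scaler_sumr; apply: eq_bigr => S _.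
  rewrite linearZZ scalerA [_ * _]mulrC.
  have [->|/d_coef_neq0/andP[UT _]] := eqVneq (d_coef (sval U) (sval T)) 0.
    by rewrite mulr0 !scale0r.
  by rewrite d_part_comp.
apply: big1 => S _; rewrite (_ : \sum_(U : index_set i') _ = 0) ?scale0r //.
have [->|ii'] := eqVneq i' (i + 1); last first.
  apply: big1 => U _.
  have [->|/d_coef_neq0/andP[_ /eqP SU]] := eqVneq (d_coef (sval S) (sval U)) 0.
    by rewrite mul0r.
  case/eqP: ii'; rewrite -(eqP (svalP U)) -(eqP (svalP S)) SU.
  by rewrite -addn1 PoszD.
rewrite -[RHS](d_coef_square (sval S) (sval T)).
rewrite -(big_sub [pred U : {set 'I_n} | #|U|%:Z == i + 1]
  (fun U => d_coef (sval S) U * d_coef U (sval T))) big_mkcond /=.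
apply: eq_bigr => U _; rewrite inE; case: ifP => // /negP Ui.
have [->|/d_coef_neq0/andP[_ /eqP SU]] := eqVneq (d_coef (sval S) U) 0.
  by rewrite mul0r.
by case: Ui; rewrite SU -addn1 PoszD (eqP (svalP S)).
Qed.

Definition Cd : complex K := Complex Cd_diff_degree Cd_diff_square.
End ChainComplex.

(* The exterior powers of degree greater than dim V vanish, so this direct sum
   over all j is finite. *)
Definition Cd_total n (A : arrangement n) : complex K := csum (fun j => Cd A j).

Definition Hd n (A : arrangement n) (i : int) : lmodType K :=
  homology (Cd_total A) i.
End Arrangements.

(* Main.v *)
From HB Require Import structures.
Require Import Defs.
From mathcomp Require Import boolp.
From mathcomp Require Import all_boot all_order all_algebra.

Set Implicit Arguments.
Unset Strict Implicit.
Unset Printing Implicit Defensive.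

Import GRing.Theory.
Local Open Scope ring_scope.

(** Every space in the three complexes is a flat of the ambient arrangement [A]:
    a subset [S] of the index set without [l] labels the flat of [S] in the
    deletion and the flat of [l |: S] in the restriction, and a subset [X] of
    the full index set is of exactly one of these two shapes. So, as graded
    vector spaces, the complex of [A] is the sum of that of the deletion and
    that of the restriction shifted by one, [iota] and [pi] being the injection
    and the projection.

    Orthogonal projections compose along nested flats, and the restricted form
    gives the same projections between subspaces of [H_l] as the ambient form
    ([restr_proj]). Hence the differentials, [iota], [pi] and the splitting maps
    are all of one kind: a matrix of scalars, indexed by pairs of subsets, times
    the exterior powers of the orthogonal projections ([mat_map]). Such maps
    compose by multiplying the scalar matrices ([mat_map_comp]), so that
    compatibility with the differentials and split exactness become identities
    between signs. The only sign that matters is the one that [l] contributes: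
    the differential out of [l |: S] in direction [r] differs from the one out
    of [S] by [-1] exactly when [l < r]. It is absorbed by letting [iota] act on
    the summand of [S] as the sign [(-1)^#{s in S | l < s}]
    ([iota_coef_diff]), while [pi] needs none ([pi_coef_diff]).

    The exact sequences of the separate exterior degrees add up to one of the
    total complexes ([csum_short_exact]), and the long exact sequence is the
    usual zigzag argument ([long_exact_sequence]). Injectivity of
    [H^0(A) -> H^0(A - H_l)] holds since the restriction complex vanishes in
    degree [-1]. *)

(** * The long exact homology sequence *)

Section ZigZag.
Variable K : fieldType.

(** In this and in several lemmas below the degrees are related by an equation
    such as [i = k + 1], so that they apply both at [(i - 1, i)] and at
    [(i, i + 1)], where [i - 1 + 1] and [i + 1 - 1] do not reduce. *)
Lemma homology_class_eq0_from (C : complex K) (k i : int) (z : Defs.cycle C i) :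
  i = k + 1 ->
  homology_class C i z = 0 <-> exists y, cdiff C k i y = val z.
Proof.
move=> ik; have -> : k = i - 1 by rewrite ik addrK.
exact: homology_class_eq0.
Qed.

Lemma homology_class_eq (C : complex K) (k i : int) (z z' : Defs.cycle C i) y :
  i = k + 1 -> val z = val z' + cdiff C k i y ->
  homology_class C i z = homology_class C i z'.
Proof.
move=> ik zz'; apply/eqP; rewrite -subr_eq0 -linearB; apply/eqP.
apply/(homology_class_eq0_from _ ik); exists y.
by rewrite linearB /= zz' addrC addKr.
Qed.

Lemma cycle_diff (C : complex K) (i k : int) (z : Defs.cycle C i) :
  cdiff C i k (val z) = 0.
Proof.
have [->|] := eqVneq k (i + 1); first by apply/eqP; exact: (valP z).
exact: cdiff_degree.
Qed.

Lemma cycle_exists (C : complex K) (i : int) (x : C i) k :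
  k = i + 1 -> cdiff C i k x = 0 -> exists z : Defs.cycle C i, val z = x.
Proof.
move=> -> /eqP dx.
by exists (exist (fun x => x \in ker_pred (cdiff C i (i + 1))) x dx).
Qed.

Lemma cmap_diff_from (p : int) (A B : complex K) (f : chain_map p A B)
    (i k i' k' : int) x : k = i + 1 -> k' = i' + 1 ->
  f k k' (cdiff A i k x) = cdiff B i' k' (f i i' x).
Proof. by move=> -> ->; exact: cmap_diff. Qed.

Variables (A B C : complex K) (iota : chain_map 1 A B) (pi : chain_map 0 B C).
Hypothesis exactABC : short_exact iota pi.

Lemma short_exact_inj k i : i = k + 1 -> injective (iota k i).
Proof.
move=> ik; have -> : k = i - 1 by rewrite ik addrK.
by case: (exactABC i).
Qed.

Lemma short_exact_mid k i : i = k + 1 -> exact_at (iota k i) (pi i i).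
Proof.
move=> ik; have -> : k = i - 1 by rewrite ik addrK.
by case: (exactABC i).
Qed.

Lemma short_exact_surj i (z : C i) : exists y, pi i i y = z.
Proof. by case: (exactABC i). Qed.

(** The relation from [H^i(C)] to [H^i(A)] given by lifting [z] to [y] and
    pulling the differential of [y] back to [x]. On homology classes it is the
    graph of the connecting map: it is linear ([zigzagP]), total
    ([zigzag_total]) and single-valued ([zigzag_functional]). *)
Definition zigzag i (z : Defs.cycle C i) (y : B i) (x : Defs.cycle A i) :=
  pi i i y = val z /\ iota i (i + 1) (val x) = cdiff B i (i + 1) y.

Lemma zigzagP i a (z z' : Defs.cycle C i) y y' (x x' : Defs.cycle A i) :
  zigzag z y x -> zigzag z' y' x' ->
  zigzag (a *: z + z') (a *: y + y') (a *: x + x').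
Proof.
move=> [pz iz] [pz' iz'].
by split; rewrite !linearP /= ?(pz, iz) ?(pz', iz').
Qed.

Lemma zigzag_total i (z : Defs.cycle C i) : exists y x, zigzag z y x.
Proof.
have [y pyz] := short_exact_surj (val z); exists y.
have : pi (i + 1) (i + 1) (cdiff B i (i + 1) y) = 0.
  by rewrite (@cmap_diff_from _ _ _ pi i _ i) // pyz cycle_diff.
move=> /(short_exact_mid erefl)[x ixdy].
have [] := @cycle_exists A i x (i + 1) erefl; last first.
  by move=> c cx; exists c; rewrite /zigzag cx.
apply: (@short_exact_inj (i + 1) (i + 1 + 1)) => //.
by rewrite linear0 cmap_diff ixdy cdiff_square.
Qed.

(** If [z] is the boundary of [w], lift [w] to [u]: then [y] minus the boundary
    of [u] comes from some [a] in [A], and the boundary of [a] is [x]. By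
    linearity this makes the class of [x] depend on the class of [z] alone. *)
Lemma zigzag_functional i (z : Defs.cycle C i) y (x : Defs.cycle A i) :
  zigzag z y x -> homology_class C i z = 0 -> homology_class A i x = 0.
Proof.
have i1 : i = i - 1 + 1 by rewrite subrK.
move=> [pyz ixdy] /homology_class_eq0[w dwz].
have [u puw] := short_exact_surj w.
have : pi i i (y - cdiff B (i - 1) i u) = 0.
  by rewrite linearB /= (@cmap_diff_from _ _ _ pi (i - 1) i (i - 1) i) // puw dwz pyz subrr.
move=> /(short_exact_mid i1)[a iay].
apply/homology_class_eq0; exists a.
apply: (@short_exact_inj i (i + 1)) => //.
rewrite (@cmap_diff_from _ _ _ iota (i - 1) i i (i + 1)) // iay ixdy.
by rewrite linearB /= cdiff_square subr0.
Qed.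

Lemma connecting_exists i : exists delta : {linear homology C i -> homology A i},
  forall z y x, zigzag z y x ->
    delta (homology_class C i z) = homology_class A i x.
Proof.
pose R q h := exists z y x,
  [/\ zigzag z y x, homology_class C i z = q & homology_class A i x = h].
have Rtotal q : exists h, R q h.
  have [z <-] := homology_classW q; have [y [x zyx]] := zigzag_total z.
  by exists (homology_class A i x), z, y, x.
have RP a q q' h h' : R q h -> R q' h' -> R (a *: q + q') (a *: h + h').
  move=> [z [y [x [zyx <- <-]]]] [z' [y' [x' [zyx' <- <-]]]].
  exists (a *: z + z'), (a *: y + y'), (a *: x + x').
  by split; [exact: zigzagP | rewrite linearP | rewrite linearP].
have R0 h : R 0 h -> h = 0.
  by move=> [z [y [x [zyx z0 <-]]]]; exact: zigzag_functional zyx z0.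
have Rfun q h h' : R q h -> R q h' -> h = h'.
  move=> Rh Rh'; apply/eqP; rewrite -subr_eq0; apply/eqP/R0.
  by have := RP (-1) _ _ _ _ Rh' Rh; rewrite !scaleN1r addNr addrC.
pose d q := projT1 (cid (Rtotal q)).
have dR q : R q (d q) by exact: projT2 (cid (Rtotal q)).
have dlin : linear d by move=> a p q; apply: Rfun (dR _) _; exact: RP.
pose dL := GRing.isLinear.Build K (homology C i) (homology A i) *:%R d dlin.
exists (HB.pack_for {linear homology C i -> homology A i} d dL).
by move=> z y x zyx /=; apply: Rfun (dR _) _; exists z, y, x.
Qed.

Section LongExact.
Variable delta : forall i, {linear homology C i -> homology A i}.
Hypothesis deltaP : connecting_map iota pi delta.

Lemma zigzag_delta i (z : Defs.cycle C i) y x : zigzag z y x ->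
  delta i (homology_class C i z) = homology_class A i x.
Proof. by case; exact: deltaP. Qed.

Lemma homology_exact_mid i :
  exact_at (homology_map iota (i - 1) i) (homology_map pi i i).
Proof.
have i1 : i = i - 1 + 1 by rewrite subrK.
move=> h; split.
  have [z <-] := homology_classW h; rewrite homology_mapE.
  move=> /homology_class_eq0[c dc]; have [b pb] := short_exact_surj c.
  have : pi i i (val z - cdiff B (i - 1) i b) = 0.
    by rewrite linearB /= (@cmap_diff_from _ _ _ pi (i - 1) i (i - 1) i) // pb dc subrr.
  move=> /(short_exact_mid i1)[a ia].
  have [] := @cycle_exists A (i - 1) a i i1.
    apply: (@short_exact_inj i (i + 1)) => //.
    rewrite (@cmap_diff_from _ _ _ iota (i - 1) i i (i + 1)) // ia linear0.
    by rewrite linearB /= cdiff_square cycle_diff subrr.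
  move=> x xa; exists (homology_class A (i - 1) x); rewrite homology_mapE.
  apply: (@homology_class_eq _ (i - 1) _ _ _ (- b)) => //=.
  by rewrite xa ia linearN.
move=> [g <-]; have [x <-] := homology_classW g; rewrite !homology_mapE.
apply/homology_class_eq0; exists 0; rewrite linear0 /=.
by apply/esym/(short_exact_mid i1); exists (val x).
Qed.

Lemma homology_exact_right i : exact_at (homology_map pi i i) (delta i).
Proof.
have i1 : i = i - 1 + 1 by rewrite subrK.
move=> h; split; last first.
  move=> [g <-]; have [y <-] := homology_classW g; rewrite homology_mapE.
  rewrite (@zigzag_delta _ _ (val y) 0) ?linear0 //; split=> //.
  by rewrite cycle_diff linear0.
have [z <-] := homology_classW h; have [y [x zyx]] := zigzag_total z.
rewrite (zigzag_delta zyx) => /homology_class_eq0[a dax].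
have [pyz ixdy] := zyx.
have [] := @cycle_exists B i (y - iota (i - 1) i a) (i + 1) erefl.
  rewrite linearB /= -ixdy -dax.
  by rewrite (@cmap_diff_from _ _ _ iota (i - 1) i i (i + 1)) // subrr.
move=> w wE; exists (homology_class B i w); rewrite homology_mapE.
congr (homology_class _ _ _); apply: val_inj => /=.
rewrite wE linearB /= pyz.
have -> : pi i i (iota (i - 1) i a) = 0 by apply/(short_exact_mid i1); exists a.
by rewrite subr0.
Qed.

Lemma homology_exact_left i : exact_at (delta i) (homology_map iota i (i + 1)).
Proof.
move=> h; split.
  have [x <-] := homology_classW h; rewrite homology_mapE.
  move=> /(homology_class_eq0_from _ erefl)[y dy].
  have [] := @cycle_exists C i (pi i i y) (i + 1) erefl.
    rewrite -(@cmap_diff_from _ _ _ pi i (i + 1) i) // dy /=.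
    by apply/(short_exact_mid erefl); exists (val x).
  move=> z zE; exists (homology_class C i z).
  by apply: (@zigzag_delta _ _ y).
move=> [g <-]; have [z <-] := homology_classW g.
have [y [x zyx]] := zigzag_total z; rewrite (zigzag_delta zyx) homology_mapE.
by apply/(homology_class_eq0_from _ erefl); exists y; rewrite /= zyx.2.
Qed.

(** By exactness at [H^0(B)], the kernel of [H^0(B) -> H^0(C)] is the image of
    [H^(-1)(A)]. *)
Lemma long_exactW : (forall a : A (-1), a = 0) -> long_exact iota pi delta.
Proof.
move=> A0; split=> [|i]; last first.
  split; [exact: homology_exact_mid | exact: homology_exact_right |].
  exact: homology_exact_left.
apply: raddf_inj => h /(homology_exact_mid (i := 0))[g <-].
have [x <-] := homology_classW g.
have -> : x = 0 by apply: val_inj; exact: A0.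
by rewrite !linear0.
Qed.
End LongExact.

Lemma long_exact_sequence : (forall a : A (-1), a = 0) ->
  exists delta, connecting_map iota pi delta /\ long_exact iota pi delta.
Proof.
move=> A0; pose delta i := projT1 (cid (connecting_exists i)).
have deltaP : connecting_map iota pi delta.
  move=> i z y x pyz ix; have := projT2 (cid (connecting_exists i)).
  by move=> /(_ z y x (conj pyz ix)).
by exists delta; split=> //; exact: long_exactW.
Qed.
End ZigZag.

(** * Direct sums of short exact sequences *)

Section DirectSumExact.
Variables (K : fieldType) (I : eqType) (A B C : I -> complex K).
Variables (iota : forall j, chain_map 1 (A j) (B j)).
Variables (pi : forall j, chain_map 0 (B j) (C j)).

(** Componentwise preimages are chosen to be zero over zero, which keeps the
    chosen family finitely supported. *)
Lemma dsum_map_preim (M N : I -> lmodType K) (f : forall j, {linear M j -> N j})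
    (y : dsum N) :
  (forall j, exists x, f j x = val y j) -> exists x, dsum_map f x = y.
Proof.
move=> fy.
have fy0 j : exists x, f j x = val y j /\ (val y j = 0 -> x = 0).
  have [y0|y0] := eqVneq (val y j) 0; first by exists 0; rewrite linear0 y0.
  by have [x xy] := fy j; exists x; split=> // /eqP; rewrite (negbTE y0).
pose x : dprod M := fun j => projT1 (cid (fy0 j)).
have xP j : f j (x j) = val y j /\ (val y j = 0 -> x j = 0).
  exact: projT2 (cid (fy0 j)).
have xfin : x \in finsupp_pred (M := M).
  have /finsupp_predP[s ys] := valP y; apply/finsupp_predP; exists s => j /ys.
  exact: (xP j).2.
exists (exist (fun x => x \in finsupp_pred (M := M)) x xfin).
by apply/val_inj/dprodP => j; exact: (xP j).1.
Qed.

Lemma csum_short_exact : (forall j, short_exact (iota j) (pi j)) ->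
  short_exact (csum_map iota) (csum_map pi).
Proof.
move=> ex i; split=> [x x' xx'|y|z].
- apply/val_inj/dprodP => j; have [inj _ _] := ex j i; apply: inj.
  by have /(congr1 (fun y => val y j)) := xx'.
- split=> [py|[x <-]].
    apply: dsum_map_preim => j; have [_ mid _] := ex j i; apply/mid.
    by have /(congr1 (fun y => val y j)) := py.
  apply/val_inj/dprodP => j; have [_ mid _] := ex j i; apply/mid.
  by exists (val x j).
- by apply: dsum_map_preim => j; have [_ _ sur] := ex j i; exact: sur.
Qed.
End DirectSumExact.

(** * Signs and subsets of the index set *)

Section Coefficients.
Variables (K : fieldType) (n : nat) (l : 'I_n).
Implicit Types (S T U : {set 'I_n.-1}) (X Y : {set 'I_n}).

(** The subset of the index set of [A] that labels, in the deletion, the flat of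
    [S]; its companion [pushl] plays this part for the restriction. *)
Definition push S : {set 'I_n} := [set lift l s | s in S].
Definition pushl S : {set 'I_n} := l |: push S.

Lemma mem_push S r : (lift l r \in push S) = (r \in S).
Proof. exact: mem_imset lift_inj. Qed.

Lemma lNpush S : l \notin push S.
Proof. by apply/imsetP=> -[r _ /eqP]; rewrite (negbTE (neq_lift l r)). Qed.

Lemma mem_pushl S r : (lift l r \in pushl S) = (r \in S).
Proof. by rewrite in_setU1 eq_sym (negbTE (neq_lift l r)) mem_push. Qed.

Lemma l_pushl S : l \in pushl S. Proof. exact: setU11. Qed.

Lemma card_push S : #|push S| = #|S|.
Proof. exact/card_imset/lift_inj. Qed.

Lemma card_pushl S : #|pushl S| = #|S|.+1.
Proof. by rewrite cardsU1 lNpush card_push. Qed.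

Lemma eq_push S T : (push S == push T) = (S == T).
Proof. exact/inj_eq/imset_inj/lift_inj. Qed.

Lemma eq_pushl S T : (pushl S == pushl T) = (S == T).
Proof.
apply/eqP/eqP=> [ST|-> //]; apply/setP=> r.
by rewrite -!mem_pushl ST.
Qed.

Lemma push_pushl S T : (push S == pushl T) = false.
Proof. by apply/eqP=> ST; have := lNpush S; rewrite ST l_pushl. Qed.

Lemma pushU1 r S : push (r |: S) = lift l r |: push S.
Proof. by rewrite /push imsetU1. Qed.

Lemma pushlU1 r S : pushl (r |: S) = lift l r |: pushl S.
Proof. by rewrite /pushl pushU1 setUCA. Qed.

Lemma pushP X : l \notin X -> exists S, X = push S.
Proof.
move=> lX; exists (lift l @^-1: X); apply/setP=> r.
case: (unliftP l r) => [s ->|->]; first by rewrite mem_push inE.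
by rewrite (negbTE lX) (negbTE (lNpush _)).
Qed.

Lemma pushlP X : l \in X -> exists S, X = pushl S.
Proof.
move=> lX; have [|S XS] := @pushP (X :\ l); first by rewrite setD11.
by exists S; rewrite /pushl -XS setD1K.
Qed.

Lemma ltn_lift (r s : 'I_n.-1) : (lift l r < lift l s)%N = (r < s)%N.
Proof. by rewrite !ltnNge leq_bump2. Qed.

Lemma eps_push S r : eps K (push S) (lift l r) = eps K S r.
Proof.
rewrite /eps -[in RHS]card_push; congr (_ ^+ _); apply: eq_card.
move=> s; rewrite !inE; case: (unliftP l s) => [t ->|->].
  by rewrite !mem_push inE ltn_lift.
by rewrite !(negbTE (lNpush _)).
Qed.

(** Since [lift l] is increasing, it preserves the signs of the differential. The
    direction [l] itself does not occur between two subsets that avoid [l]. *)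
Lemma d_coef_push S T : d_coef K (push S) (push T) = d_coef K S T.
Proof.
rewrite /d_coef big_mkcond (bigD1_ord l) //= -big_mkcond ifF ?add0r; last first.
  apply/andP=> -[_ /eqP ST]; have := lNpush T.
  by rewrite ST setU11.
apply: eq_big => [r|r _]; last exact: eps_push.
by rewrite mem_push -pushU1 eq_push.
Qed.

(** The factor by which [iota] must twist the summand of [S]: adding [r] to [S]
    changes it by [-1] exactly when [l < r], which is how [l] changes the sign of
    the differential in direction [r]. *)
Definition sgnl S : K := (-1) ^+ #|[set s in S | (l < lift l s)%N]|.

Lemma sgnlK S : sgnl S * sgnl S = 1.
Proof. by rewrite /sgnl -signr_odd -signr_addb addbb. Qed.

Lemma sgnlU1 r S : r \notin S ->
  sgnl (r |: S) = (-1) ^+ (l < lift l r)%N * sgnl S.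
Proof.
move=> rS; rewrite /sgnl -exprD; congr (_ ^+ _).
have -> : [set s in r |: S | (l < lift l s)%N] =
    if (l < lift l r)%N then r |: [set s in S | (l < lift l s)%N]
    else [set s in S | (l < lift l s)%N].
  by apply/setP=> s; case: ifP => rt; rewrite !inE;
    have [->|] := eqVneq s r; rewrite ?rt ?andbF.
by case: ifP => _; rewrite ?cardsU1 ?inE ?(negbTE rS).
Qed.

Lemma d_coef_pushl S T :
  sgnl S * d_coef K (pushl S) (pushl T) = sgnl T * d_coef K S T.
Proof.
rewrite /d_coef [in LHS]big_mkcond (bigD1_ord l) //= -big_mkcond.
rewrite ifF ?add0r; last by rewrite l_pushl.
rewrite !big_distrr /=; apply: eq_big => [r|r].
  by rewrite mem_pushl -pushlU1 eq_pushl.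
rewrite mem_pushl -pushlU1 eq_pushl => /andP[rS /eqP->].
rewrite sgnlU1 // epsU1 ?lNpush // eps_push.
by rewrite mulrCA mulrA.
Qed.

(** The matrices of [iota] and [pi]. Their transposes are the matrices of the
    maps that split the short exact sequence. *)
Definition iota_coef S X : K := (X == pushl S)%:R * sgnl S.
Definition pi_coef X S : K := (X == push S)%:R.

Lemma iota_coef_neq0 S X : iota_coef S X != 0 -> X = pushl S.
Proof. by rewrite /iota_coef; case: (X =P _) => // _; rewrite mulr0n mul0r eqxx. Qed.

Lemma pi_coef_neq0 S X : pi_coef X S != 0 -> X = push S.
Proof. by rewrite /pi_coef; case: (X =P _) => // _; rewrite mulr0n eqxx. Qed.

Lemma sum_indicator (I : finType) (i0 : I) (P : pred I) (F : I -> K) :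
  P =1 pred1 i0 -> \sum_i (P i)%:R * F i = F i0.
Proof.
move=> PE; rewrite (bigD1 i0) //= PE /= eqxx mul1r big1 ?addr0 // => i ii0.
by rewrite PE /= (negbTE ii0) mulr0n mul0r.
Qed.

Lemma sum_iota_coefl S (F : {set 'I_n} -> K) :
  \sum_X iota_coef S X * F X = sgnl S * F (pushl S).
Proof.
under eq_bigr => X _ do rewrite /iota_coef -mulrA.
exact: (@sum_indicator _ (pushl S) (fun X => X == pushl S)).
Qed.

Lemma sum_iota_coefr (F : {set 'I_n.-1} -> K) S0 :
  \sum_S iota_coef S (pushl S0) * F S = sgnl S0 * F S0.
Proof.
under eq_bigr => S _ do rewrite /iota_coef -mulrA eq_pushl eq_sym.
exact: (@sum_indicator _ S0 (fun S => S == S0)).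
Qed.

Lemma sum_pi_coefl S (F : {set 'I_n} -> K) :
  \sum_X pi_coef X S * F X = F (push S).
Proof. exact: (@sum_indicator _ (push S) (fun X => X == push S)). Qed.

Lemma sum_pi_coefr S0 (F : {set 'I_n.-1} -> K) :
  \sum_S pi_coef (push S0) S * F S = F S0.
Proof.
under eq_bigr => S _ do rewrite /pi_coef eq_push eq_sym.
exact: (@sum_indicator _ S0 (fun S => S == S0)).
Qed.

Lemma iota_coef_push S T : iota_coef S (push T) = 0.
Proof. by rewrite /iota_coef push_pushl mulr0n mul0r. Qed.

Lemma pi_coef_pushl S T : pi_coef (pushl S) T = 0.
Proof. by rewrite /pi_coef eq_sym push_pushl. Qed.

(** A subset that contains [l] can only be enlarged to one that contains [l], so
    both sides vanish unless [X] is of the form [pushl T]. *)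
Lemma iota_coef_diff S X : \sum_Y iota_coef S Y * d_coef K Y X =
  \sum_T d_coef K S T * iota_coef T X.
Proof.
rewrite sum_iota_coefl; under [RHS]eq_bigr => T _ do rewrite mulrC.
have [lX|lX] := boolP (l \in X).
  have [T ->] := pushlP lX.
  by rewrite sum_iota_coefr // d_coef_pushl.
rewrite [RHS]big1 => [|T _].
  have [->|/d_coef_neq0/andP[/subsetP/(_ l (l_pushl S))]] :=
    eqVneq (d_coef K (pushl S) X) 0; first by rewrite mulr0.
  by rewrite (negbTE lX).
by have [S' ->] := pushP lX; rewrite iota_coef_push mul0r.
Qed.

(** Dually, a subset contained in one that avoids [l] avoids [l]. *)
Lemma pi_coef_diff X T : \sum_Y d_coef K X Y * pi_coef Y T =
  \sum_S pi_coef X S * d_coef K S T.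
Proof.
under eq_bigr => Y _ do rewrite mulrC.
rewrite sum_pi_coefl; have [lX|lX] := boolP (l \in X); last first.
  by have [S ->] := pushP lX; rewrite sum_pi_coefr d_coef_push.
have [S XS] := pushlP lX; rewrite [RHS]big1 => [|S' _]; last first.
  by rewrite XS pi_coef_pushl mul0r.
have [//|/d_coef_neq0/andP[/subsetP/(_ l lX)]] := eqVneq (d_coef K X (push T)) 0.
by rewrite (negbTE (lNpush _)).
Qed.

Lemma iota_coef_retr S T : \sum_X iota_coef S X * iota_coef T X = (S == T)%:R.
Proof.
rewrite sum_iota_coefl /iota_coef eq_pushl.
by case: eqP => [->|_]; rewrite ?mulr0n ?mul0r ?mulr0 // mulr1n mul1r sgnlK.
Qed.

Lemma pi_coef_section S T : \sum_X pi_coef X S * pi_coef X T = (S == T)%:R.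
Proof. by rewrite sum_pi_coefl /pi_coef eq_push. Qed.

Lemma iota_pi_coef S T : \sum_X iota_coef S X * pi_coef X T = 0.
Proof. by rewrite sum_iota_coefl pi_coef_pushl mulr0. Qed.

(** Every [X] is either some [pushl S] or some [push S], and [sgnl S] squares to
    one. *)
Lemma iota_pi_coef_split X Y :
  \sum_S iota_coef S X * iota_coef S Y + \sum_S pi_coef X S * pi_coef Y S =
  (X == Y)%:R.
Proof.
have [lX|lX] := boolP (l \in X).
  have [S ->] := pushlP lX; rewrite sum_iota_coefr // [X in _ + X]big1 ?addr0.
    rewrite /iota_coef eq_sym; case: eqP => _.
      by rewrite mulr1n mul1r sgnlK.
    by rewrite mulr0n mul0r mulr0.
  by move=> T _; rewrite pi_coef_pushl mul0r.
have [S ->] := pushP lX; rewrite sum_pi_coefr big1 ?add0r.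
  by rewrite /pi_coef eq_sym.
by move=> T _; rewrite iota_coef_push mul0r.
Qed.
End Coefficients.

(** * Maps assembled from orthogonal projections *)

Section Charts.
Variables (K : fieldType) (V : vectType K) (form : {symmetric V}).

(** A space identified with a subspace of [V], together with the orthogonal
    projection of [V] onto it. A flat of the restriction is a subspace of [H_l],
    not of [V], and charts put it on the same footing as the flats of [A]. *)
Record chart := Chart {
  chart_sub : {vspace V};
  chart_nondeg : nondegenerate_on form chart_sub;
  chart_dom : lmodType K;
  chart_in : {linear chart_dom -> V};
  chart_out : {linear V -> chart_dom};
  chart_inK : cancel chart_in chart_out;
  chart_outK : forall v, chart_in (chart_out v) = orth_proj form chart_sub v
}.

Definition transition (c d : chart) : {linear chart_dom c -> chart_dom d} :=
  chart_out d \o chart_in c.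

Lemma transition_id c : transition c c =1 id.
Proof. exact: chart_inK. Qed.

(** Passing through [d] is harmless if [d] contains the source, where the
    projection onto [d] is the identity, or the target, by composition of nested
    projections. *)
Lemma transition_comp c d e u :
  (chart_sub c <= chart_sub d)%VS || (chart_sub e <= chart_sub d)%VS ->
  transition d e (transition c d u) = transition c e u.
Proof.
rewrite /transition /= chart_outK; case/orP=> [cd|ed].
  rewrite orth_proj_id //; first exact: chart_nondeg.
  by apply: subvP cd _ _; rewrite -(chart_inK u) chart_outK orth_proj_mem.
apply: (can_inj (chart_inK (c := e))).
by rewrite !chart_outK orth_proj_comp //; exact: chart_nondeg.
Qed.

Lemma ext_map_eq j (U W : lmodType K) (f g : {linear U -> W}) :
  f =1 g -> ext_map j f =1 ext_map j g.
Proof.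
move=> fg; apply: ext_lift_unique => t; rewrite !ext_map_wedge.
by congr wedge; apply/ffunP=> i; rewrite !ffunE fg.
Qed.

Lemma ext_map_id j (U : lmodType K) (f : {linear U -> U}) :
  f =1 id -> ext_map j f =1 id.
Proof.
move=> fid; apply: (@ext_lift_unique _ _ _ _ (ext_map j f) idfun) => t.
rewrite ext_map_wedge /=.
by congr wedge; apply/ffunP=> i; rewrite !ffunE fid.
Qed.

Variable j : nat.

Definition chart_sum m (F : {set 'I_m} -> chart) (i : int) : lmodType K :=
  dprod (fun S : index_set m i => ext j (chart_dom (F (sval S)))).

Section MatrixMap.
Variables (m m' : nat) (F : {set 'I_m} -> chart) (G : {set 'I_m'} -> chart).
Variable a : {set 'I_m} -> {set 'I_m'} -> K.
Variables i i' : int.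

Definition mat_fun (x : chart_sum F i) : chart_sum G i' := fun T =>
  \sum_(S : index_set m i) a (sval S) (sval T) *:
    ext_map j (transition (F (sval S)) (G (sval T))) (x S).

Lemma mat_fun_is_linear : linear mat_fun.
Proof.
move=> c x y; apply: dprodP => T; rewrite dprodDE dprodZE /mat_fun.
rewrite scaler_sumr -big_split; apply: eq_bigr => S _.
by rewrite dprodDE dprodZE linearP [RHS]addrC scalerDr addrC !scalerA mulrC.
Qed.

HB.instance Definition _ := GRing.isLinear.Build K (chart_sum F i)
  (chart_sum G i') *:%R mat_fun mat_fun_is_linear.

Definition mat_map : {linear chart_sum F i -> chart_sum G i'} := mat_fun.

Lemma mat_mapE x T : mat_map x T = \sum_(S : index_set m i)
  a (sval S) (sval T) *: ext_map j (transition (F (sval S)) (G (sval T))) (x S).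
Proof. by []. Qed.
End MatrixMap.

Lemma mat_map_eq m m' (F : {set 'I_m} -> chart) (G : {set 'I_m'} -> chart)
    (a b : {set 'I_m} -> {set 'I_m'} -> K) i i' x :
  (forall (S : {set 'I_m}) (T : {set 'I_m'}),
    #|S|%:Z = i -> #|T|%:Z = i' -> a S T = b S T) ->
  mat_map F G a i i' x = mat_map F G b i i' x.
Proof.
move=> ab; apply: dprodP => T; rewrite !mat_mapE; apply: eq_bigr => S _.
by rewrite ab //; apply/eqP; [exact: (svalP S) | exact: (svalP T)].
Qed.

Lemma mat_map0 m m' (F : {set 'I_m} -> chart) (G : {set 'I_m'} -> chart)
    (a : {set 'I_m} -> {set 'I_m'} -> K) i i' x :
  (forall (S : {set 'I_m}) (T : {set 'I_m'}),
    #|S|%:Z = i -> #|T|%:Z = i' -> a S T = 0) ->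
  mat_map F G a i i' x = 0.
Proof.
move=> a0; apply: dprodP => T; rewrite mat_mapE; apply: big1 => S _.
by rewrite a0 ?scale0r //; apply/eqP; [exact: (svalP S) | exact: (svalP T)].
Qed.

Lemma mat_map_id m (F : {set 'I_m} -> chart) i x :
  mat_map F F (fun S T => (S == T)%:R) i i x = x.
Proof.
apply: dprodP => T; rewrite mat_mapE (bigD1 T) // eqxx scale1r.
rewrite (ext_map_id (@transition_id _)) big1; first exact: addr0.
move=> S; rewrite andTb.
by rewrite -val_eqE /= => /negbTE->; rewrite scale0r.
Qed.

Lemma mat_mapD m m' (F : {set 'I_m} -> chart) (G : {set 'I_m'} -> chart)
    a b i i' x :
  mat_map F G a i i' x + mat_map F G b i i' x =
  mat_map F G (fun S T => a S T + b S T) i i' x.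
Proof.
apply: dprodP => T; rewrite dprodDE !mat_mapE -big_split; apply: eq_bigr => S _.
exact/esym/scalerDl.
Qed.

(** Matrix multiplication. The intermediate index of a nonzero product of
    coefficients must be of the intermediate degree, so that the sum over all
    subsets agrees with the one over that degree, and its chart must be large
    enough for [transition_comp]. *)
Lemma mat_map_comp m1 m2 m3 (F : {set 'I_m1} -> chart) (G : {set 'I_m2} -> chart)
    (H : {set 'I_m3} -> chart) (a : {set 'I_m1} -> {set 'I_m2} -> K)
    (b : {set 'I_m2} -> {set 'I_m3} -> K) i i' i'' x :
  (forall (S : {set 'I_m1}) (U : {set 'I_m2}) (T : {set 'I_m3}),
    #|S|%:Z = i -> #|T|%:Z = i'' -> a S U != 0 ->
    b U T != 0 -> #|U|%:Z = i' /\
      ((chart_sub (F S) <= chart_sub (G U))%VS ||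
       (chart_sub (H T) <= chart_sub (G U))%VS)) ->
  mat_map G H b i' i'' (mat_map F G a i i' x) =
  mat_map F H (fun S T => \sum_U a S U * b U T) i i'' x.
Proof.
move=> abP; apply: dprodP => T; rewrite !mat_mapE.
under eq_bigr => U _ do rewrite mat_mapE linear_sum scaler_sumr.
rewrite exchange_big; apply: eq_bigr => S _.
have cS := eqP (svalP S); have cT := eqP (svalP T).
transitivity ((\sum_(U : index_set m2 i') a (sval S) (sval U) * b (sval U) (sval T))
    *: ext_map j (transition (F (sval S)) (H (sval T))) (x S)).
  rewrite scaler_suml; apply: eq_bigr => U _; rewrite linearZZ scalerA mulrC.
  have [->|a0] := eqVneq (a (sval S) (sval U)) 0; first by rewrite mul0r !scale0r.
  have [->|b0] := eqVneq (b (sval U) (sval T)) 0; first by rewrite mulr0 !scale0r.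
  congr (_ *: _); apply: ext_map_comp => u; apply: transition_comp.
  by case: (abP _ _ _ cS cT a0 b0).
congr (_ *: _).
rewrite -(big_sub [pred U : {set 'I_m2} | #|U|%:Z == i']
  (fun U => a (sval S) U * b U (sval T))) big_mkcond /=.
apply: eq_bigr => U _; rewrite inE; case: eqP => // Ui.
have [->|a0] := eqVneq (a (sval S) U) 0; first by rewrite mul0r.
have [->|b0] := eqVneq (b U (sval T)) 0; first by rewrite mulr0.
by case: (abP _ _ _ cS cT a0 b0).
Qed.
End Charts.

(** * The flats of an arrangement and of its restriction *)

Section ArrangementCharts.
Variables (K : fieldType) (n : nat) (A : arrangement K n).

Definition flat_out (S : {set 'I_n}) :
    {linear arr_space A -> subvs_of (flat A S)} :=
  vsproj (flat A S) \o orth_proj (arr_form A) (flat A S).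

Lemma flat_inK S : cancel (vsval : subvs_of (flat A S) -> _) (flat_out S).
Proof.
move=> u; rewrite /flat_out /= orth_proj_id ?vsvalK ?subvsP //.
exact: arr_nondeg.
Qed.

Lemma flat_outK S v : vsval (flat_out S v) = orth_proj (arr_form A) (flat A S) v.
Proof. by rewrite /flat_out /= vsprojK // orth_proj_mem. Qed.

Definition flat_chart (S : {set 'I_n}) : chart (arr_form A) :=
  Chart (@arr_nondeg K n A S) (@flat_inK S) (@flat_outK S).

Lemma Cd_diff_mat j i i' (x : Cd_obj A j i) :
  Cd_diff A j i i' x =
  mat_map j flat_chart flat_chart (d_coef K (n := n)) i i' x.
Proof.
apply: dprodP => T; rewrite [LHS]Cd_diff_funE mat_mapE.
by apply: eq_bigr => S _; congr (_ *: _); apply: ext_map_eq.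
Qed.

Variable l : 'I_n.
Local Notation R := (restriction A l).

Definition restr_in (S : {set 'I_n.-1}) :
    {linear subvs_of (flat R S) -> arr_space A} := vsval \o vsval.

Definition restr_out (S : {set 'I_n.-1}) :
    {linear arr_space A -> subvs_of (flat R S)} :=
  vsproj (flat R S) \o vsproj (arr_hyp A l) \o
    orth_proj (arr_form A) (flat A (pushl l S)).

Lemma pushl_flat_hyp S v : v \in flat A (pushl l S) -> v \in arr_hyp A l.
Proof. by move=> /mem_flat_of; apply; exact: l_pushl. Qed.

Lemma restr_outK S v :
  restr_in S (restr_out S v) = orth_proj (arr_form A) (flat A (pushl l S)) v.
Proof.
have vS := orth_proj_mem (arr_form A) (flat A (pushl l S)) v.
rewrite /restr_in /restr_out /= vsprojK ?vsprojK //; first exact: pushl_flat_hyp vS.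
by rewrite mem_restr_flat vsprojK //; exact: pushl_flat_hyp vS.
Qed.

Lemma restr_in_mem S (u : subvs_of (flat R S)) :
  restr_in S u \in flat A (pushl l S).
Proof. by rewrite /restr_in /= -mem_restr_flat subvsP. Qed.

Lemma restr_inK S : cancel (restr_in S) (restr_out S).
Proof.
move=> u; apply: val_inj; apply: val_inj.
rewrite -[LHS]/(restr_in S _) restr_outK orth_proj_id ?restr_in_mem //.
exact: arr_nondeg.
Qed.

Definition restr_chart (S : {set 'I_n.-1}) : chart (arr_form A) :=
  Chart (@arr_nondeg K n A (pushl l S)) (@restr_inK S) (@restr_outK S).

(** Both sides lie in the flat, and the restricted form is the ambient one on
    vectors of [H_l], so this is uniqueness of the orthogonal projection. *)
Lemma restr_proj (S : {set 'I_n.-1}) (u : arr_space R) :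
  vsval (orth_proj (arr_form R) (flat R S) u) =
  orth_proj (arr_form A) (flat A (pushl l S)) (vsval u).
Proof.
apply/esym/orth_proj_unique; first exact: arr_nondeg.
  by rewrite -mem_restr_flat orth_proj_mem.
move=> w wS; have wl := pushl_flat_hyp wS.
rewrite -(vsprojK wl) -linearB.
apply: (orth_projP (form := arr_form R) u (@arr_nondeg _ _ R S)
  (x := vsproj _ w)).
by rewrite mem_restr_flat vsprojK.
Qed.

Lemma flat_proj_restr S T u :
  flat_proj R S T u = transition (restr_chart S) (restr_chart T) u.
Proof.
apply: val_inj; apply: val_inj.
rewrite -[RHS]/(restr_in T (restr_out T (restr_in S u))) restr_outK.
by rewrite /flat_proj /= vsprojK ?orth_proj_mem // restr_proj.
Qed.

Lemma Cd_diff_restr j i i' (x : Cd_obj R j i) :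
  Cd_diff R j i i' x =
  mat_map j restr_chart restr_chart (d_coef K (n := n.-1)) i i' x.
Proof.
apply: dprodP => T; rewrite [LHS]Cd_diff_funE mat_mapE.
apply: eq_bigr => S _; congr (_ *: _); apply: ext_map_eq => u.
exact: flat_proj_restr.
Qed.
End ArrangementCharts.

(** * The short exact sequence of deletion and restriction *)

Section DeletionRestrictionMaps.
Variables (K : fieldType) (n : nat) (A : arrangement K n) (l : 'I_n) (j : nat).

Local Notation FA := (flat_chart A).
Local Notation FR := (restr_chart A l).
Definition del_chart : {set 'I_n.-1} -> chart (arr_form A) :=
  flat_chart (deletion A l).
Local Notation FD := del_chart.

Lemma del_chart_sub S : chart_sub (FD S) = flat A (push l S).
Proof. exact: flat_lift. Qed.

Definition iota_map i i' : {linear Cd (restriction A l) j i -> Cd A j i'} :=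
  mat_map j FR FA (iota_coef K l) i i'.
Definition pi_map i i' : {linear Cd A j i -> Cd (deletion A l) j i'} :=
  mat_map j FA FD (pi_coef K l) i i'.

Lemma iota_degree i i' x : i' != i + 1 -> iota_map i i' x = 0.
Proof.
move=> ii'; apply: (@mat_map0 _ _ _ j _ _ FR FA) => S X Si Xi.
apply/eqP; apply: contraNT ii'.
by move=> /iota_coef_neq0 XE; rewrite -Xi XE card_pushl -addn1 PoszD Si.
Qed.

Lemma pi_degree i i' x : i' != i + 0 -> pi_map i i' x = 0.
Proof.
rewrite addr0 => ii'; apply: (@mat_map0 _ _ _ j _ _ FA FD) => X S Xi Si.
apply/eqP; apply: contraNT ii'.
by move=> /pi_coef_neq0 XE; rewrite -Xi XE card_push Si.
Qed.

Lemma d_coef_deg m (S T : {set 'I_m}) :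
  d_coef K S T != 0 -> #|T|%:Z = #|S|%:Z + 1.
Proof. by move=> /d_coef_neq0/andP[_ /eqP->]; rewrite -addn1 PoszD. Qed.

Lemma iota_diff i i' x :
  iota_map (i + 1) (i' + 1) (cdiff (Cd (restriction A l) j) i (i + 1) x) =
  cdiff (Cd A j) i' (i' + 1) (iota_map i i' x).
Proof.
rewrite /= Cd_diff_restr Cd_diff_mat /iota_map !mat_map_comp.
- by apply: (@mat_map_eq _ _ _ j _ _ FR FA) => S X _ _; rewrite iota_coef_diff.
- move=> S Y X Si Xi /iota_coef_neq0-> /d_coef_deg; rewrite Xi => /addIr ->.
  by rewrite /= subvv.
- move=> S T X Si Xi /d_coef_deg-> /iota_coef_neq0->; rewrite Si.
  by rewrite /= subvv orbT.
Qed.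

Lemma pi_diff i i' x :
  pi_map (i + 1) (i' + 1) (cdiff (Cd A j) i (i + 1) x) =
  cdiff (Cd (deletion A l) j) i' (i' + 1) (pi_map i i' x).
Proof.
rewrite /= Cd_diff_mat [RHS](@Cd_diff_mat _ _ (deletion A l)) /pi_map.
rewrite mat_map_comp; last first.
  move=> X Y T Xi Ti /d_coef_deg-> /pi_coef_neq0->; rewrite Xi.
  by rewrite del_chart_sub subvv orbT.
rewrite [RHS](@mat_map_comp K (arr_space A) (arr_form A) j _ _ _ FA FD FD).
  by apply: (@mat_map_eq _ _ _ j _ _ FA FD) => X T _ _; rewrite pi_coef_diff.
move=> X S T Xi Ti /pi_coef_neq0-> /d_coef_deg; rewrite Ti => /addIr ->.
by rewrite del_chart_sub subvv.
Qed.

Definition restr_incl : chain_map 1 (Cd (restriction A l) j) (Cd A j) :=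
  ChainMap iota_degree iota_diff.
Definition del_proj : chain_map 0 (Cd A j) (Cd (deletion A l) j) :=
  ChainMap pi_degree pi_diff.

(** These two maps split the sequence in each degree; they need not commute
    with the differentials. *)
Definition retr i : {linear Cd A j i -> Cd (restriction A l) j (i - 1)} :=
  mat_map j FA FR (fun X S => iota_coef K l S X) i (i - 1).
Definition sect i : {linear Cd (deletion A l) j i -> Cd A j i} :=
  mat_map j FD FA (fun S X => pi_coef K l X S) i i.

Lemma retr_iota i x : retr i (iota_map (i - 1) i x) = x.
Proof.
rewrite /retr /iota_map mat_map_comp.
  rewrite -[RHS](@mat_map_id K (arr_space A) (arr_form A) j _ FR).
  apply: (@mat_map_eq _ _ _ j _ _ FR FR) => S T _ _.
  exact: iota_coef_retr.
move=> S X T Si Ti /iota_coef_neq0-> _; rewrite subvv; split=> //.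
by rewrite card_pushl -addn1 PoszD Si subrK.
Qed.

Lemma pi_sect i x : pi_map i i (sect i x) = x.
Proof.
rewrite /sect /pi_map mat_map_comp.
  rewrite -[RHS](@mat_map_id K (arr_space A) (arr_form A) j _ FD).
  apply: (@mat_map_eq _ _ _ j _ _ FD FD) => S T _ _.
  exact: pi_coef_section.
move=> S X T Si Ti /pi_coef_neq0-> _; rewrite del_chart_sub subvv; split=> //.
by rewrite card_push Si.
Qed.

Lemma pi_iota i x : pi_map i i (iota_map (i - 1) i x) = 0.
Proof.
rewrite /iota_map /pi_map mat_map_comp.
  by apply: (@mat_map0 _ _ _ j _ _ FR FD) => S T _ _; exact: iota_pi_coef.
move=> S X T Si Ti /iota_coef_neq0-> _; rewrite subvv; split=> //.
by rewrite card_pushl -addn1 PoszD Si subrK.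
Qed.

Lemma iota_retr_sect_pi i x :
  iota_map (i - 1) i (retr i x) + sect i (pi_map i i x) = x.
Proof.
rewrite /iota_map /retr /sect /pi_map !mat_map_comp; last first.
- move=> X S Y Xi Yi /iota_coef_neq0 XE _; rewrite -Xi XE subvv; split=> //.
  by rewrite card_pushl -addn1 PoszD addrK.
- move=> X S Y Xi Yi /pi_coef_neq0 XE _; rewrite -Xi XE del_chart_sub subvv; split=> //.
  by rewrite card_push.
rewrite [LHS](@mat_mapD _ _ _ j _ _ FA FA).
rewrite -[RHS](@mat_map_id K (arr_space A) (arr_form A) j _ FA).
by apply: (@mat_map_eq _ _ _ j _ _ FA FA) => X Y _ _; exact: iota_pi_coef_split.
Qed.

Lemma deletion_restriction_short_exact : short_exact restr_incl del_proj.
Proof.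
move=> i; split=> [|y|z]; first exact: can_inj (@retr_iota i).
  split=> [pyE|[x <-]]; last exact: pi_iota.
  exists (retr i y); rewrite -[RHS](iota_retr_sect_pi y).
  by rewrite -[pi_map _ _ _]/(del_proj i i y) pyE linear0 addr0.
by exists (sect i z); exact: pi_sect.
Qed.
End DeletionRestrictionMaps.

Lemma Cd_total_negative (K : fieldType) n (A : arrangement K n)
    (x : Cd_total A (-1)) : x = 0.
Proof.
apply/val_inj/dprodP => j; apply: dprodP => S.
by have := svalP S.
Qed.

Theorem theorem2p8 (K : fieldType) (charK : [pchar K] =i pred0) (n : nat)
    (V : vector_arrangement K n) (l : 'I_n) :
  let H := hyperplanes V in
  exists (iota : forall j : nat, chain_map 1 (Cd (restriction H l) j) (Cd H j))
         (pi : forall j : nat, chain_map 0 (Cd H j) (Cd (deletion H l) j)),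
    (forall j : nat, short_exact (iota j) (pi j)) /\
    (exists delta : forall i : int,
        {linear Hd (deletion H l) i -> Hd (restriction H l) i},
      connecting_map (csum_map iota) (csum_map pi) delta /\
      long_exact (csum_map iota) (csum_map pi) delta).
Proof.
move=> H; exists (restr_incl H l), (del_proj H l).
have ex j := deletion_restriction_short_exact H l j; split=> //.
apply: long_exact_sequence; first exact: csum_short_exact.
exact: Cd_total_negative.
Qed.
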